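(* Let $m$ be a positive integer, $V=\mathbb F_{2^m}^2$, and let $G=(V,+)$ be its additive abelian group. Let $\mathcal S$ be the Desarguesian $m$-spread of $V$, and set $\ell=2^{m-1}-1$. Let $\mathcal A\subseteq\mathcal S$ with $|\mathcal A|=\ell$, let $P=\bigcup_{U\in\mathcal A}(U\setminus\{0\})$, and define $D=P-0_G\in\mathbb Z[G]$. Then $D$ is an SDS in $G$ with parameters \[ (v,k,\lambda)=\left(2^{2m},\; 2^{2m-1}-3\cdot 2^{m-1}+2,\; 2^{2m-2}-3\cdot 2^{m-1}+2\right). \]
   Context: The Desarguesian $m$-spread of $V=\mathbb F_{2^m}^2$ is the collection $\mathcal S=\{U_a: a\in\mathbb F_{2^m}\}\cup\{U_\infty\}$ of subsets of $V$, where $U_a=\{(x,ax):x\in\mathbb F_{2^m}\}$ and $U_\infty=\{(0,x):x\in\mathbb F_{2^m}\}$; it has $2^m+1$ members. Let $G$ be a finite group of order $v$, with identity denoted $0_G$. In the integral group ring $\mathbb Z[G]$, identify a subset $U\subseteq G$ with $\sum_{u\in U}u$, and for $D=\sum_{g\in G}a_g g$ write $D^{(-1)}=\sum_{g\in G}a_g g^{-1}$ (where $g^{-1}$ is the inverse of $g$ in $G$, i.e. $-g$ in additive notation). Thus $D=P-0_G$ is the element with coefficient $1$ on $P$, coefficient $-1$ at the identity $0_G$, and $0$ elsewhere. A signed subset of $G$ is an element $D=\sum_{g\in G}a_g g\in\mathbb Z[G]$ with all $a_g\in\{0,1,-1\}$; its support size is $k=|\{g\in G: a_g\neq 0\}|$.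 A signed subset $D$ of support size $k$ is a $(v,k,\lambda)$-signed difference set (SDS), with $\lambda\in\mathbb Z$, if $DD^{(-1)}=(k-\lambda)0_G+\lambda G$ in $\mathbb Z[G]$ (so the coefficient of the identity is $k$ and every other coefficient is $\lambda$). *)

(* Defs.v *)
From HB Require Import structures.
From mathcomp Require Import all_boot all_order all_algebra all_fingroup.

Set Implicit Arguments.
Unset Strict Implicit.
Unset Printing Implicit Defensive.

Import GRing.Theory.
Local Open Scope ring_scope.

(* The integral group ring Z[G] of G = gT. The alias hides the pointwise
   product of {ffun gT -> int}, so that [*] is the convolution product. *)
Definition groupRing (gT : finGroupType) : Type := {ffun gT -> int}.

Section GroupRing.
Variable gT : finGroupType.

HB.instance Definition _ := GRing.Zmodule.copy (groupRing gT) {ffun gT -> int}.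

Definition gr_coef (x : groupRing gT) : gT -> int :=
  fun_of_fin (x : {ffun gT -> int}).

Definition gr_set (U : {set gT}) : groupRing gT :=
  [ffun g : gT => ((g \in U) : nat)%:Z].

Definition gr_elt (g : gT) : groupRing gT := gr_set [set g].

Definition gr_mul (x y : groupRing gT) : groupRing gT :=
  [ffun g : gT => \sum_(h : gT) gr_coef x h * gr_coef y (h^-1 * g)%g].

Lemma gr_mulA : associative gr_mul.
Proof.
move=> x y z; apply/ffunP => g; rewrite !ffunE.
transitivity (\sum_(h : gT) \sum_(j : gT)
   gr_coef x h * gr_coef y (h^-1 * j)%g * gr_coef z (j^-1 * g)%g).
  apply: eq_bigr => h _; rewrite /gr_coef ffunE big_distrr /=.
  rewrite (reindex_inj (mulgI h^-1%g)) /=.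
  by apply: eq_bigr => j _; rewrite mulrA invMg invgK -mulgA mulKVg.
rewrite exchange_big /=; apply: eq_bigr => j _.
by rewrite /gr_coef ffunE big_distrl.
Qed.

Lemma gr_mul1g : left_id (gr_elt 1%g) gr_mul.
Proof.
move=> x; apply/ffunP => g; rewrite ffunE (bigD1 1%g) //= big1 ?addr0.
  by rewrite /gr_coef ffunE set11 mul1r invg1 mul1g.
by move=> h h1; rewrite /gr_coef ffunE inE (negPf h1) mul0r.
Qed.

Lemma gr_mulg1 : right_id (gr_elt 1%g) gr_mul.
Proof.
move=> x; apply/ffunP => g; rewrite ffunE (bigD1 g) //= big1 ?addr0.
  by rewrite /gr_coef ffunE mulVg set11 mulr1.
move=> h hg; rewrite /gr_coef ffunE inE -eq_mulVg1.
by rewrite (negPf hg) mulr0.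
Qed.

Lemma gr_mulDl : left_distributive gr_mul +%R.
Proof.
move=> x y z; apply/ffunP => g; rewrite !ffunE -big_split /=.
by apply: eq_bigr => h _; rewrite /gr_coef ffunE mulrDl.
Qed.

Lemma gr_mulDr : right_distributive gr_mul +%R.
Proof.
move=> x y z; apply/ffunP => g; rewrite !ffunE -big_split /=.
by apply: eq_bigr => h _; rewrite /gr_coef ffunE mulrDr.
Qed.

Lemma gr_oner_neq0 : gr_elt 1%g != 0.
Proof. by apply/eqP => /ffunP /(_ 1%g); rewrite !ffunE set11. Qed.

HB.instance Definition _ := GRing.Zmodule_isNzRing.Build (groupRing gT)
  gr_mulA gr_mul1g gr_mulg1 gr_mulDl gr_mulDr gr_oner_neq0.

(* D^(-1) *)
Definition gr_inv (x : groupRing gT) : groupRing gT :=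
  [ffun g : gT => gr_coef x g^-1%g].

Definition signed_subset (D : groupRing gT) : Prop :=
  forall g : gT, gr_coef D g \in [:: 0; 1; -1].

Definition gr_supp (D : groupRing gT) : {set gT} :=
  [set g | gr_coef D g != 0].

(* v and k are integers, like lambda, so that concrete parameters can be
   written without truncated subtraction. *)
Definition is_SDS (v k lambda : int) (D : groupRing gT) : Prop :=
  [/\ #|gT|%:Z = v,
      signed_subset D,
      #|gr_supp D|%:Z = k
    & D * gr_inv D =
        gr_elt 1%g *~ (k - lambda) + gr_set [set: gT] *~ lambda].

End GroupRing.

Section Spread.
Variable F : finFieldType.

(* As a finGroupType, F * F is the direct product of two copies of (F, +), so
   its group law is the addition of the plane. *)
Lemma plane_mulgE (x y : F * F) : (x * y)%g = x + y. Proof. by []. Qed.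
Lemma plane_oneE : 1%g = 0 :> F * F. Proof. by []. Qed.
Lemma plane_invgE (x : F * F) : (x^-1)%g = - x. Proof. by []. Qed.

Definition spread_line (a : F) : {set F * F} := [set (x, a * x) | x : F].

Definition spread_line_inf : {set F * F} := [set (0, x) | x : F].

Definition desarguesian_spread : {set {set F * F}} :=
  spread_line_inf |: [set spread_line a | a : F].

End Spread.

(* Main.v *)
Require Import Defs.
From HB Require Import structures.
From mathcomp Require Import all_boot all_order all_algebra all_fingroup.
From mathcomp Require Import zify ring.

Set Implicit Arguments.
Unset Strict Implicit.
Unset Printing Implicit Defensive.

Import GRing.Theory.
Local Open Scope ring_scope.

(** The members of a spread are subgroups U of order q = 2 n of a group G of
    order q ^ 2, any two of which meet only in the identity. In Z[G] such
    subgroups multiply in the simplest possible way: U U = q U, and U W = G for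
    U <> W, because every element of G factors uniquely in U W.

    Let S be the sum of the n - 1 members of A. Removing the identity from each
    member makes the union disjoint, so P = S - (n - 1) 1 and D = S - n 1; this
    element is fixed by D |-> D^(-1). Squaring,
      D D^(-1) = S S - 2 n S + n^2 1, where S S = q S + (n - 1) (n - 2) G,
    and q = 2 n makes the terms in S cancel. What is left is
      D D^(-1) = n^2 1 + (n - 1) (n - 2) G,
    so lambda = (n - 1) (n - 2) and k - lambda = n^2. The support size
    then comes out of the same identity: for a signed subset it is the sum of
    the squared coefficients, that is, the coefficient of D D^(-1) at the
    identity.

    This is [partial_spread_SDS]. The members of the Desarguesian spread are
    such subgroups with n = 2 ^ (m - 1), being the lines through the origin of
    the plane over a field of order 2 n. *)

(** * Arithmetic in the integral group ring *)

Section GroupRingArithmetic.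
Variable gT : finGroupType.
Implicit Types (x y : groupRing gT) (g : gT) (U W : {set gT}).

Lemma gr_coef_inj x y : gr_coef x =1 gr_coef y -> x = y.
Proof. by move=> xy; apply/ffunP. Qed.

Lemma gr_coef_set U g : gr_coef (gr_set U) g = ((g \in U) : nat)%:Z.
Proof. by rewrite /gr_coef ffunE. Qed.

Lemma gr_coefD x y g : gr_coef (x + y) g = gr_coef x g + gr_coef y g.
Proof. by rewrite /gr_coef ffunE. Qed.

Lemma gr_coefN x g : gr_coef (- x) g = - gr_coef x g.
Proof. by rewrite /gr_coef ffunE. Qed.

Lemma gr_coef_sum (I : finType) (Q : pred I) (E : I -> groupRing gT) g :
  gr_coef (\sum_(i | Q i) E i) g = \sum_(i | Q i) gr_coef (E i) g.
Proof.
apply: (big_morph (fun x => gr_coef x g)) => [x y|]; first exact: gr_coefD.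
by rewrite /gr_coef ffunE.
Qed.

Lemma gr_coefMz x (c : int) g : gr_coef (x *~ c) g = gr_coef x g * c.
Proof.
have coefMn n : gr_coef (x *+ n) g = gr_coef x g * n%:Z.
  elim: n => [|n IHn]; first by rewrite mulr0n /gr_coef ffunE mulr0.
  by rewrite mulrS gr_coefD IHn intS mulrDr mulr1.
case: c => n; first exact: coefMn.
by rewrite NegzE mulrNz gr_coefN coefMn mulrN.
Qed.

Lemma gr_coefM x y g :
  gr_coef (x * y) g = \sum_(h : gT) gr_coef x h * gr_coef y (h^-1 * g)%g.
Proof. by rewrite /gr_coef ffunE. Qed.

Lemma gr_elt1 : gr_elt 1%g = 1 :> groupRing gT.
Proof. by []. Qed.

Lemma gr_inv_is_zmod_morphism : zmod_morphism (@gr_inv gT).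
Proof. by move=> x y; apply/ffunP => g; rewrite !ffunE /gr_coef !ffunE. Qed.

HB.instance Definition _ :=
  GRing.isZmodMorphism.Build (groupRing gT) (groupRing gT) (@gr_inv gT)
    gr_inv_is_zmod_morphism.

Lemma gr_inv_group (U : {group gT}) : gr_inv (gr_set U) = gr_set U.
Proof. by apply/ffunP => g; rewrite !ffunE /gr_coef !ffunE groupV. Qed.

Lemma gr_inv1 : gr_inv 1 = 1 :> groupRing gT.
Proof. exact: (gr_inv_group 1%G). Qed.

Lemma gr_set_bigcup (I : finType) (Q : pred I) (B : I -> {set gT}) :
    (forall i j, Q i -> Q j -> i != j -> [disjoint B i & B j]) ->
  gr_set (\bigcup_(i | Q i) B i) = \sum_(i | Q i) gr_set (B i).
Proof.
move=> tiB; apply: gr_coef_inj => g; rewrite gr_coef_sum gr_coef_set.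
have [/bigcupP[i Qi Big] | gnB] := boolP (g \in _).
  rewrite (bigD1 i) //= big1 ?gr_coef_set ?Big ?addr0 // => j /andP[Qj ji].
  by rewrite gr_coef_set (disjointFl (tiB _ _ Qj Qi ji) Big).
rewrite big1 // => i Qi; rewrite gr_coef_set.
by case: (boolP (g \in B i)) => // Big; case/bigcupP: gnB; exists i.
Qed.

Lemma gr_setD1 U : 1%g \in U -> gr_set (U :\ 1%g) = gr_set U - 1.
Proof.
move=> U1; apply: gr_coef_inj => g.
rewrite gr_coefD gr_coefN -gr_elt1 !gr_coef_set !inE.
by case: eqVneq => [->|_]; rewrite ?U1 ?subr0.
Qed.

(** Left translation by an element of U permutes U, so each of the #|U| elements
    contributes one copy of U. *)
Lemma gr_set_group_sqr (U : {group gT}) :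
  gr_set U * gr_set U = gr_set U *~ #|U|%:Z.
Proof.
apply: gr_coef_inj => g; rewrite gr_coefM gr_coefMz gr_coef_set.
rewrite -sum1_card (big_morph Posz PoszD (erefl _)) mulr_sumr [RHS]big_mkcond.
apply: eq_bigr => h _ /=; rewrite !gr_coef_set.
case: (boolP (h \in U)) => Uh; last by rewrite mul0r.
by rewrite groupMl ?groupV // mul1r mulr1.
Qed.

(** The order condition forces U W = G as sets, and the trivial intersection
    makes the factorization u w of each element unique. *)
Lemma gr_set_mul_complement (U W : {group gT}) :
  U :&: W = 1%g -> (#|U| * #|W|)%N = #|gT| ->
  gr_set U * gr_set W = gr_set [set: gT].
Proof.
move=> tiUW cardUW; apply: gr_coef_inj => g; rewrite gr_coefM gr_coef_set inE.
have UWT : (U * W)%g = [set: gT].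
  by apply/eqP; rewrite eqEcard subsetT TI_cardMg // cardsT cardUW /=.
have: g \in (U * W)%g by rewrite UWT inE.
case/mulsgP=> u w Uu Ww ->.
rewrite (bigD1 u) //= big1 ?addr0 => [|h hu].
  by rewrite !gr_coef_set Uu mulKg Ww.
rewrite !gr_coef_set; case: (boolP (h \in U)) => Uh; last by rewrite mul0r.
rewrite mulgA groupMr //; case: (boolP (_ \in W)) => // Whu.
have: (h^-1 * u)%g \in U :&: W by rewrite inE Whu groupM ?groupV.
by rewrite tiUW => /set1gP/eqP; rewrite -eq_mulVg1 (negPf hu).
Qed.

(** A coefficient in {0, 1, -1} has square 1 or 0 according to whether it is
    nonzero, and the coefficient of D D^(-1) at the identity is the sum of these
    squares. *)
Lemma signed_subset_card_supp (D : groupRing gT) :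
  signed_subset D -> #|gr_supp D|%:Z = gr_coef (D * gr_inv D) 1%g.
Proof.
move=> sD; rewrite gr_coefM -sum1_card (big_morph Posz PoszD (erefl _)).
rewrite big_mkcond; apply: eq_bigr => h _ /=; rewrite inE.
rewrite [gr_coef (gr_inv D) _]ffunE mulg1 invgK.
by have:= sD h; rewrite !inE => /or3P[]/eqP->.
Qed.

(** * Signed difference sets from partial spreads *)

(** Multiplying S by a fixed member U on the left gives q U from U itself and
    one copy of G from each of the #|A| - 1 other members. *)
Lemma partial_spread_sum_sqr (A : {set {set gT}}) (q : nat) :
    #|gT| = (q ^ 2)%N ->
    {in A, forall U, group_set U} -> {in A, forall U, #|U| = q} ->
    {in A &, forall U W, U != W -> U :&: W = 1%g} ->
  let S : groupRing gT := \sum_(U in A) gr_set U in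
  S * S = S *~ q%:Z + gr_set [set: gT] *~ (#|A|%:Z * (#|A|%:Z - 1)).
Proof.
move=> cardG grA cardA tiA S.
have mulUS U : U \in A ->
    gr_set U * S = gr_set U *~ q%:Z + gr_set [set: gT] *~ (#|A|%:Z - 1).
  move=> AU; rewrite /S mulr_sumr (bigD1 U) //=; congr (_ + _).
    by rewrite -(cardA U AU) -(gr_set_group_sqr (Group (grA U AU))).
  rewrite (eq_bigr (fun=> gr_set [set: gT])) => [|W /andP[AW WU] /=].
    rewrite sumr_const pmulrn; congr (_ *~ _).
    rewrite (cardsD1 U A) AU -[in LHS](@eq_card _ (mem (A :\ U))).
      by rewrite PoszD addrC addKr.
    by move=> W; rewrite !inE andbC.
  apply: (@gr_set_mul_complement (Group (grA U AU)) (Group (grA W AW))).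
    by apply: tiA => //; rewrite eq_sym.
  by rewrite /= !cardA // cardG.
rewrite {1}/S mulr_suml (eq_bigr _ mulUS) big_split /= -mulrz_suml; congr (_ + _).
by rewrite sumr_const pmulrn -mulrzA mulrC.
Qed.

(** The relation between n and #|A| is chosen so that D = S - n 1, with S the
    sum of the members of A: the cross terms - 2 n S of the square then cancel
    the term q S of S S, each member having q = 2 n elements. *)
Lemma partial_spread_SDS (A : {set {set gT}}) (n : nat) :
    #|gT| = ((2 * n) ^ 2)%N -> #|A|.+1 = n ->
    {in A, forall U, group_set U} -> {in A, forall U, #|U| = (2 * n)%N} ->
    {in A &, forall U W, U != W -> U :&: W = 1%g} ->
  is_SDS (4 * n%:Z ^+ 2) (2 * n%:Z ^+ 2 - 3 * n%:Z + 2)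
         (n%:Z ^+ 2 - 3 * n%:Z + 2)
         (gr_set (\bigcup_(U in A) (U :\ 1%g)) - gr_elt 1%g).
Proof.
move=> cardG cardA grA cardU tiA.
set P := \bigcup_(U in A) _; set D := gr_set P - _.
pose S : groupRing gT := \sum_(U in A) gr_set U.
have DE : D = S - 1 *~ n%:Z.
  rewrite /D gr_elt1 gr_set_bigcup => [|U W AU AW UW]; last first.
    apply/pred0P=> g; apply/negP=> /andP[/setD1P[/eqP g1 Ug] /setD1P[_ Wg]].
    have: g \in U :&: W by rewrite inE Ug.
    by rewrite tiA // => /set1gP.
  rewrite (eq_bigr (fun U => gr_set U - 1)) => [|U AU]; last first.
    exact: gr_setD1 (group1 (Group (grA U AU))).
  by rewrite sumrB sumr_const -addrA -opprD -mulrSr cardA.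
have invD : gr_inv D = D.
  rewrite DE raddfB raddfMz raddf_sum /= gr_inv1; congr (_ - _).
  by apply: eq_bigr => U AU; apply: (gr_inv_group (Group (grA U AU))).
have DD : D * gr_inv D = gr_elt 1%g *~ (n%:Z ^+ 2)
            + gr_set [set: gT] *~ (n%:Z ^+ 2 - 3 * n%:Z + 2).
  rewrite invD DE mulrBr !mulrBl (partial_spread_sum_sqr cardG grA cardU tiA).
  rewrite -/S !mulrzAl !mulrzAr !mul1r !mulr1.
  apply: gr_coef_inj => g.
  rewrite gr_elt1 !(gr_coefD, gr_coefN, gr_coefMz) PoszM -cardA intS; ring.
have sD : signed_subset D.
  move=> g; rewrite gr_coefD gr_coefN !gr_coef_set in_set1.
  case: (eqVneq g 1%g) => [->|_]; last by case: (g \in P).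
  suff /negPf-> : 1%g \notin P by [].
  by apply/bigcupP=> -[U _]; rewrite !inE eqxx.
split=> //.
- by rewrite cardG; lia.
- rewrite signed_subset_card_supp // DD gr_coefD !gr_coefMz !gr_coef_set.
  by rewrite set11 in_setT !mul1r; ring.
- by rewrite DD; congr (_ *~ _ + _); ring.
Qed.

End GroupRingArithmetic.

(** * The members of the Desarguesian spread *)

Section DesarguesianSpread.
Variable F : finFieldType.
Implicit Types (U W : {set F * F}) (v : F * F).

Lemma in_spread_line a v : (v \in spread_line a) = (v.2 == a * v.1).
Proof.
case: v => x y; apply/imsetP/eqP => [[z _ [-> ->]] //|/= ->]; by exists x.
Qed.

Lemma in_spread_line_inf v : (v \in spread_line_inf F) = (v.1 == 0).
Proof.
case: v => x y; apply/imsetP/eqP => [[z _ [-> _]] //|/= ->]; by exists y.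
Qed.

Lemma desarguesian_spreadP U :
  reflect (U = spread_line_inf F \/ exists a, U = spread_line a)
          (U \in desarguesian_spread F).
Proof.
rewrite !inE; apply: (iffP orP) => [[/eqP|/imsetP[a _]] ->|[->|[a ->]]].
- by left.
- by right; exists a.
- by left.
- by right; apply: imset_f.
Qed.

Lemma spread_group_set U : U \in desarguesian_spread F -> group_set U.
Proof.
case/desarguesian_spreadP=> [->|[a ->]]; apply/group_setP.
  split=> [|u v]; first by rewrite in_spread_line_inf plane_oneE.
  rewrite !in_spread_line_inf plane_mulgE /= => /eqP-> /eqP->.
  by rewrite addr0.
split=> [|u v]; first by rewrite in_spread_line plane_oneE /= mulr0.
rewrite !in_spread_line plane_mulgE /= => /eqP-> /eqP->.
by rewrite mulrDr.
Qed.

Lemma spread_card U : U \in desarguesian_spread F -> #|U| = #|F|.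
Proof.
by case/desarguesian_spreadP=> [->|[a ->]]; rewrite card_imset // => x y [].
Qed.

(** Lines through the origin with different slopes: a common point v gives
    (a - b) v.1 = 0. *)
Lemma spread_TI U W :
    U \in desarguesian_spread F -> W \in desarguesian_spread F ->
  U != W -> U :&: W = 1%g.
Proof.
move=> sU sW neqUW; apply/eqP; rewrite eqEsubset; apply/andP; split; last first.
  by rewrite sub1set inE (group1 (Group (spread_group_set sU)))
             (group1 (Group (spread_group_set sW))).
apply/subsetP=> -[x y]; rewrite !inE plane_oneE.
case/desarguesian_spreadP: sU neqUW => [->|[a ->]];
  case/desarguesian_spreadP: sW => [->|[b ->]];
  rewrite ?eqxx // ?in_spread_line ?in_spread_line_inf /= => neq.
- by case/andP=> /eqP-> /eqP->; rewrite mulr0.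
- by case/andP=> /eqP-> /eqP->; rewrite mulr0.
have neq_ab : a - b != 0 by rewrite subr_eq0; apply: contraNneq neq => ->.
case/andP=> /eqP-> /eqP abx; suff ->: x = 0 by rewrite mulr0.
by apply: (mulfI neq_ab); rewrite mulrBl abx subrr mulr0.
Qed.

End DesarguesianSpread.

Theorem theorem5p3 (m : nat) (hm : (0 < m)%N)
  (F : finFieldType) (hF : #|F| = (2 ^ m)%N)
  (A : {set {set F * F}})
  (hA : A \subset desarguesian_spread F)
  (hcard : #|A| = (2 ^ (m - 1) - 1)%N) :
  let P : {set F * F} := \bigcup_(U in A) (U :\ (0 : F * F)) in
  let D := gr_set P - gr_elt (0 : F * F) in
  is_SDS (2 ^+ (2 * m))
         (2 ^+ (2 * m - 1) - 3 * 2 ^+ (m - 1) + 2)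
         (2 ^+ (2 * m - 2) - 3 * 2 ^+ (m - 1) + 2)
         D.
Proof.
move=> P D; case: m hm hF hcard => // m _ hF hcard.
have ssA U : U \in A -> U \in desarguesian_spread F by apply: (subsetP hA).
have hq : #|F| = (2 * 2 ^ m)%N by rewrite hF expnS.
have cardA : #|A|.+1 = (2 ^ m)%N by rewrite hcard !subn1 prednK ?expn_gt0.
have cardG : #|{: F * F}| = ((2 * 2 ^ m) ^ 2)%N.
  by rewrite card_prod hq mulnn.
have := @partial_spread_SDS _ A (2 ^ m)%N cardG cardA
  (fun U AU => spread_group_set (ssA U AU))
  (fun U AU => etrans (spread_card (ssA U AU)) hq)
  (fun U W AU AW => spread_TI (ssA U AU) (ssA W AW)).
have -> : (2 ^ m)%N%:Z = 2 ^+ m by rewrite -natz natrX.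
have -> : (2 * m.+1 - 1 = (m * 2).+1)%N by lia.
have -> : (2 * m.+1 - 2 = m * 2)%N by lia.
have -> : (2 * m.+1 = (m * 2).+2)%N by lia.
have -> : 2 ^+ (m * 2).+2 = 4 * (2 ^+ m) ^+ 2 :> int.
  by rewrite 2!exprS exprM mulrA.
have -> : 2 ^+ (m * 2).+1 = 2 * (2 ^+ m) ^+ 2 :> int by rewrite exprS exprM.
by rewrite exprM subn1.
Qed.
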